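(* Let $\Delta$ be a finite simplicial complex on the vertex set $[n]$, and let $G(\Delta)$ be its non-comparability graph. Then $G(\Delta)$ belongs to the class $\mathcal{G}$. Moreover, $\Delta$ is pure if and only if $G(\Delta)$ is well-covered.
   Context: Graphs are finite, with no loops or multiple edges. A (finite) simplicial complex $\Delta$ on $[n]=\{1,\ldots,n\}$ is a collection of subsets of $[n]$ such that $\{i\}\in\Delta$ for each $i\in[n]$, and $E\in\Delta$, $F\subseteq E$ imply $F\in\Delta$. Elements of $\Delta$ are faces; faces maximal under inclusion are facets; $\dim F=|F|-1$. $\Delta$ is pure if all of its facets have the same dimension. The non-comparability graph $G(\Delta)$ has as vertices the nonempty faces of $\Delta$; two vertices are adjacent if and only if neither of the corresponding faces contains the other. For a graph $G$, a set of vertices is independent if no two of its vertices are adjacent, and is a clique if every two distinct vertices in it are adjacent. $\alpha(G)$ denotes the largest cardinality of an independent set of $G$. $G$ is well-covered if all maximal (with respect to inclusion) independent sets of $G$ have the same cardinality. The class $\mathcal{G}$ consists of all graphs $G$ for which there are $k=\alpha(G)$ cliques of $G$ whose union is $V(G)$. *)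

(* Defs.v *)
From mathcomp Require Import all_boot all_order all_algebra.

Set Implicit Arguments.
Unset Strict Implicit.
Unset Printing Implicit Defensive.

Record sgraph := SGraph {
  vertex :> finType;
  adj : rel vertex;
  adj_sym : symmetric adj;
  adj_irr : irreflexive adj
}.

Section Graph.
Variable G : sgraph.
Implicit Types S : {set G}.

Definition independent S : bool :=
  [forall x in S, forall y in S, ~~ adj x y].

Definition clique S : bool :=
  [forall x in S, forall y in S, (x != y) ==> adj x y].

Definition alpha : nat := \max_(S : {set G} | independent S) #|S|.

Definition maximal_independent S : bool := maxset independent S.

Definition well_covered : Prop :=
  forall S T : {set G},
    maximal_independent S -> maximal_independent T -> #|S| = #|T|.

Definition class_G : Prop :=
  exists C : {set {set G}},
    [/\ #|C| = alpha,
        forall K, K \in C -> clique K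
      & cover C = [set: G]].

End Graph.

(* The vertex set {1, ..., n} is represented by 'I_n = {0, ..., n - 1}. *)
Section Complex.
Variable n : nat.
Implicit Types (Delta : {set {set 'I_n}}) (E F : {set 'I_n}).

Definition simplicial_complex Delta : Prop :=
  (forall i : 'I_n, [set i] \in Delta) /\
  (forall E F, E \in Delta -> F \subset E -> F \in Delta).

Definition facet Delta F : bool := maxset (fun E => E \in Delta) F.

(* Integer-valued, so that the empty face has dimension -1. *)
Definition dim F : int := (Posz #|F| - 1)%R.

Definition pure Delta : Prop :=
  forall E F, facet Delta E -> facet Delta F -> dim E = dim F.

Definition nonempty_face Delta F : bool := (F \in Delta) && (F != set0).

Definition noncomparable E F : bool := ~~ (E \subset F) && ~~ (F \subset E).

Definition noncomp_adj Delta : rel {F : {set 'I_n} | nonempty_face Delta F} :=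
  fun x y => noncomparable (val x) (val y).

Lemma noncomp_adj_sym Delta : symmetric (@noncomp_adj Delta).
Proof. by move=> x y; rewrite /noncomp_adj /noncomparable andbC. Qed.

Lemma noncomp_adj_irr Delta : irreflexive (@noncomp_adj Delta).
Proof. by move=> x; rewrite /noncomp_adj /noncomparable subxx. Qed.

Definition noncomparability_graph Delta : sgraph :=
  SGraph (@noncomp_adj_sym Delta) (@noncomp_adj_irr Delta).

End Complex.

(* Main.v *)
(** Independent sets of the non-comparability graph are chains of nonempty
    faces. A maximal one contains exactly one face of each cardinality from 1 up
    to that of its largest face, and this largest face is a facet; conversely
    every nonempty facet tops a maximal chain. Hence the cardinalities of
    maximal independent sets are those of the facets. The faces of a given
    cardinality form a clique, and the cardinalities occurring in a largest chain
    index the cliques required by the class G. *)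
Require Import Defs.
From mathcomp Require Import all_boot all_order all_algebra.

Set Implicit Arguments.
Unset Strict Implicit.
Unset Printing Implicit Defensive.

(** Adjoin [k - #|A|] elements of [B :\: A] to [A]. This supplies the new face inserted between two
    faces of a chain. *)
Lemma subset_of_intermediate_card (T : finType) (A B : {set T}) (k : nat) :
  A \subset B -> #|A| <= k <= #|B| ->
  exists X : {set T}, [/\ A \subset X, X \subset B & #|X| = k].
Proof.
move=> sAB /andP[leAk lekB].
have /card_geqP[s [uniq_s size_s sub_s]] : k - #|A| <= #|B :\: A|.
  by rewrite cardsD (setIidPr sAB) leq_sub2r.
exists (A :|: [set x in s]); split; first exact: subsetUl.
  rewrite subUset sAB; apply/subsetP => x; rewrite inE => /sub_s.
  by rewrite inE => /andP[].
have disj : A :&: [set x in s] = set0.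
  apply/setP => x; rewrite !inE; apply/negP => /andP[xA /sub_s].
  by rewrite inE xA.
by rewrite cardsU disj cards0 subn0 cardsE (card_uniqP uniq_s) size_s subnKC.
Qed.

(** * Maximal independent sets in an arbitrary graph *)

Section MaximalIndependent.
Variable G : sgraph.
Implicit Types (S : {set G}) (x y : G).

Lemma independentP S :
  reflect {in S &, forall x y, ~~ adj x y} (independent S).
Proof.
apply: (iffP forall_inP) => [indS x y /indS /forall_inP|indS x xS]; first exact.
by apply/forall_inP => y; apply: indS.
Qed.

Lemma maximal_independent_mem S x :
  maximal_independent S -> {in S, forall y, ~~ adj x y} -> x \in S.
Proof.
move=> /maxsetP[/independentP indS maxS] xS.
rewrite -(maxS (x |: S)) ?setU11 ?subsetUr //.
apply/independentP => y z /setU1P[->|yS] /setU1P[->|zS].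
- by rewrite adj_irr.
- exact: xS.
- by rewrite adj_sym xS.
- exact: indS.
Qed.

Lemma maximal_independent_through x :
  exists2 S : {set G}, maximal_independent S & x \in S.
Proof.
have ind_x : independent [set x].
  by apply/independentP => y z /set1P-> /set1P->; rewrite adj_irr.
have [S maxS] := maxset_exists ind_x; rewrite sub1set => xS.
by exists S.
Qed.

Lemma independent_leq_alpha S : independent S -> #|S| <= alpha G.
Proof. exact: leq_bigmax_cond. Qed.

Lemma maximal_independent_alpha :
  exists2 S : {set G}, maximal_independent S & #|S| = alpha G.
Proof.
have ind0 : independent (set0 : {set G}).
  by apply/independentP => x y; rewrite inE.
have ex_ind : 0 < #|[pred S : {set G} | independent S]|.
  by apply/card_gt0P; exists set0.
have [S indS cardS] := eq_bigmax_cond (fun S : {set G} => #|S|) ex_ind.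
have {}cardS : #|S| = alpha G by rewrite -cardS; apply: eq_bigl.
exists S => //; apply/maxsetP; split=> [//|T indT sST]; apply/eqP.
by rewrite eq_sym eqEcard sST cardS independent_leq_alpha.
Qed.

End MaximalIndependent.

(** * Chains of nonempty faces *)

Section Chains.
Variables (n : nat) (Delta : {set {set 'I_n}}).
Hypothesis hDelta : simplicial_complex Delta.

Let G := noncomparability_graph Delta.
Implicit Types (S : {set G}) (x y : G).

Lemma nonadjE x y :
  ~~ adj x y = (val x \subset val y) || (val y \subset val x).
Proof. by rewrite /= /noncomp_adj /noncomparable negb_and !negbK. Qed.

Lemma vertex_gt0 x : 0 < #|val x|.
Proof. by rewrite card_gt0; case/andP: (valP x). Qed.

Lemma vertex_in x : val x \in Delta.
Proof. by case/andP: (valP x). Qed.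

(** Independence makes the two faces comparable, and an inclusion in the opposite direction forces
    equality by cardinality. *)
Lemma independent_leq_subset S x y :
  independent S -> x \in S -> y \in S -> #|val x| <= #|val y| ->
  val x \subset val y.
Proof.
move=> /independentP indS xS yS lexy.
have := indS _ _ xS yS; rewrite nonadjE => /orP[//|syx].
by have /eqP-> : val y == val x by rewrite eqEcard syx.
Qed.

Lemma independent_card_inj S :
  independent S -> {in S &, injective (fun x => #|val x|)}.
Proof.
move=> indS x y xS yS exy; apply/val_inj/eqP.
by rewrite eqEcard exy leqnn (independent_leq_subset indS) ?exy.
Qed.

(** A face of size [k] fits between the union [A] of the smaller members of [S] and a smallest
    member [B] of size at least [k]. It is comparable with every member of [S], so maximality puts
    it in [S]. *)
Lemma maximal_independent_fill S x k :
  maximal_independent S -> x \in S -> 0 < k <= #|val x| ->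
  exists2 y : G, y \in S & #|val y| = k.
Proof.
move=> maxS xS /andP[k_gt0 lekx].
have indS : independent S by case/maxsetP: maxS.
have [B /andP[BS lekB] minB] :=
  @arg_minnP _ x (fun y => (y \in S) && (k <= #|val y|)) (fun y => #|val y|)
    (introT andP (conj xS lekx)).
pose A := \bigcup_(y in S | #|val y| < k) val y.
have sAB : A \subset val B.
  apply/bigcupsP => y /andP[yS ltyk].
  apply: (independent_leq_subset indS) => //.
  exact: leq_trans (ltnW ltyk) lekB.
have leAk : #|A| <= k.
  (* Either no member has fewer than [k] elements and [A] is empty, or a largest such member
     contains all the others and hence [A]. *)
  have [z0 /andP[z0S ltz0]|none] :=
    pickP (fun z : G => (z \in S) && (#|val z| < k)); last first.
    by rewrite /A big_pred0 ?cards0.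
  have [z /andP[zS ltzk] maxz] :=
    @arg_maxnP _ z0 (fun z => (z \in S) && (#|val z| < k))
      (fun z => #|val z|) (introT andP (conj z0S ltz0)).
  apply: leq_trans (ltnW ltzk); apply/subset_leq_card/bigcupsP => y yP.
  case/andP: (yP) => yS _.
  by apply: (independent_leq_subset indS) => //; apply: maxz.
have [X [sAX sXB cardX]] : exists X : {set 'I_n},
    [/\ A \subset X, X \subset val B & #|X| = k].
  by apply: subset_of_intermediate_card; rewrite ?leAk.
have faceX : nonempty_face Delta X.
  rewrite /nonempty_face (hDelta.2 _ _ (vertex_in B) sXB).
  by rewrite -card_gt0 cardX.
exists (Sub X faceX : G); last by rewrite SubK.
apply: maximal_independent_mem => // y yS; rewrite nonadjE SubK.
(* Smaller members lie in [A], hence in [X]; the others contain [B], hence [X]. *)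
apply/orP; case: (ltnP #|val y| k) => [ltyk|leky].
  by right; apply: subset_trans sAX; apply: bigcup_sup; rewrite yS.
left; apply: (subset_trans sXB); apply: (independent_leq_subset indS) => //.
by apply: minB; rewrite yS.
Qed.

(** The sizes of the members are distinct and, by filling, exhaust the interval from 1 to their
    maximum [m]; counting them gives [m = #|S|]. *)
Lemma maximal_independent_cards S k :
  maximal_independent S ->
  reflect (exists2 y, y \in S & #|val y| = k) (0 < k <= #|S|).
Proof.
move=> maxS; have indS : independent S by case/maxsetP: maxS.
pose m := \max_(x in S) #|val x|.
pose cards := [seq #|val x| | x <- enum S].
have uniq_cards : uniq cards.
  rewrite map_inj_in_uniq ?enum_uniq // => x y.
  by rewrite !mem_enum; apply: independent_card_inj.
have cards_mem j : reflect (exists2 y, y \in S & #|val y| = j) (j \in cards).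
  apply: (iffP mapP) => -[y yS ej]; exists y => //; first by rewrite mem_enum in yS.
  by rewrite mem_enum.
have cardsE : cards =i iota 1 m.
  move=> j; rewrite mem_iota add1n ltnS; apply/cards_mem/andP.
    move=> [y yS <-]; rewrite vertex_gt0; split=> //.
    exact: leq_bigmax_cond.
  move=> [j_gt0 lejm]; have S_gt0 : 0 < #|S|.
    rewrite lt0n; apply/negP => /eqP/cards0_eq S0.
    by move: lejm; rewrite /m S0 big_set0 leqNgt j_gt0.
  have [x xS mE] := eq_bigmax_cond (fun x : G => #|val x|) S_gt0.
  by apply: (maximal_independent_fill maxS xS); rewrite j_gt0 -mE.
have /perm_size : perm_eq cards (iota 1 m).
  by apply: uniq_perm; rewrite ?iota_uniq.
rewrite size_map -cardE size_iota => ->.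
by move: (cardsE k); rewrite mem_iota add1n ltnS => <-.
Qed.

(** The vertex [x] excludes the graph without vertices, where the empty set is maximal
    independent. *)
Lemma maximal_independent_gt0 S x : maximal_independent S -> 0 < #|S|.
Proof.
move=> maxS; rewrite lt0n; apply/negP => /eqP/cards0_eq S0.
suff: x \in S by rewrite S0 inE.
by apply: maximal_independent_mem => // y; rewrite S0 inE.
Qed.

Lemma maximal_independent_top S x :
  maximal_independent S ->
  exists y : G, [/\ y \in S, #|val y| = #|S|
                 & {in S, forall z : G, val z \subset val y}].
Proof.
move=> maxS; have indS : independent S by case/maxsetP: maxS.
have [|y yS cardy] := @maximal_independent_cards S #|S| maxS _.
  by rewrite leqnn (maximal_independent_gt0 x).
exists y; split=> // z zS; apply: (independent_leq_subset indS) => //.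
have : 0 < #|val z| <= #|S|.
  by apply/(maximal_independent_cards _ maxS); exists z.
by rewrite cardy => /andP[].
Qed.

(** A face containing the top of the chain is comparable with all its members, so it belongs to [S]
    and cannot exceed the top. *)
Lemma maximal_independent_facet S x :
  maximal_independent S -> exists2 F, facet Delta F & #|F| = #|S|.
Proof.
move=> maxS; have [y [yS cardy topy]] := maximal_independent_top x maxS.
exists (val y) => //; apply/maxsetP; split; first exact: vertex_in.
move=> F FDelta syF; apply/eqP; rewrite eqEsubset syF andbT.
have faceF : nonempty_face Delta F.
  rewrite /nonempty_face FDelta -card_gt0.
  exact: leq_trans (vertex_gt0 y) (subset_leq_card syF).
have FS : (Sub F faceF : G) \in S.
  apply: maximal_independent_mem => // z zS; rewrite nonadjE SubK.
  by rewrite (subset_trans (topy z zS) syF) orbT.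
by have := topy _ FS; rewrite SubK.
Qed.

Lemma facet_maximal_independent F x :
  facet Delta F -> exists2 S : {set G}, maximal_independent S & #|S| = #|F|.
Proof.
case/maxsetP=> FDelta maxF.
have faceF : nonempty_face Delta F.
  rewrite /nonempty_face FDelta; apply/negP => /eqP F0.
  (* An empty facet would equal the nonempty face [x], which contains it. *)
  have := vertex_gt0 x.
  by rewrite (maxF _ (vertex_in x)) F0 ?cards0 ?sub0set.
have [S maxS FS] := maximal_independent_through (Sub F faceF : G).
exists S => //; have [y [yS <- topy]] := maximal_independent_top x maxS.
by rewrite (maxF (val y)) ?vertex_in //; have := topy _ FS; rewrite SubK.
Qed.

Lemma class_G_noncomparability_graph : class_G G.
Proof.
have [S maxS cardS] := maximal_independent_alpha G.
(* A level collects all faces of the given size, including those outside [S]. *)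
pose level x : {set G} := [set y : G | #|val y| == #|val x|].
exists (level @: S); split.
- rewrite card_in_imset // => x y xS yS /setP/(_ x).
  rewrite !inE eqxx => /esym/eqP; apply: (@independent_card_inj S) => //.
  by case/maxsetP: maxS.
- move=> _ /imsetP[x _ ->]; apply/forall_inP => y; rewrite inE => /eqP cardy.
  apply/forall_inP => z; rewrite inE => /eqP cardz; apply/implyP.
  apply: contraR; rewrite nonadjE -val_eqE !eqEcard cardy cardz leqnn andbT.
  case/orP=> [//|szy]; have /eqP-> : val z == val y.
    by rewrite eqEcard szy cardy cardz leqnn.
  exact: subxx.
apply/setP => y; rewrite [in RHS]inE; apply/bigcupP.
(* A maximal chain [T] through [y] gives [#|val y| <= #|T| <= #|S|], so [S] has a member of the same
   size as [y]. *)
have [T maxT yT] := maximal_independent_through y.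
have [|x xS cardx] := @maximal_independent_cards S #|val y| maxS _.
  have /andP[-> ley] : 0 < #|val y| <= #|T|.
    by apply/(maximal_independent_cards _ maxT); exists y.
  apply: leq_trans ley _; rewrite cardS.
  by apply: independent_leq_alpha; case/maxsetP: maxT.
by exists (level x); rewrite ?imset_f // inE cardx.
Qed.

Lemma dim_eq (E F : {set 'I_n}) : Defs.dim E = Defs.dim F <-> #|E| = #|F|.
Proof. by split=> [/GRing.addIr[]|EF] //; rewrite /Defs.dim EF. Qed.

Lemma pure_well_covered : pure Delta <-> well_covered G.
Proof.
split=> [pureD S T maxS maxT|wcG E F facetE facetF].
  have [x _|noG] := pickP (fun x : G => true); last first.
    by rewrite !eq_card0 // => x; have := noG x.
  have [E facetE <-] := maximal_independent_facet x maxS.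
  have [F facetF <-] := maximal_independent_facet x maxT.
  by apply/dim_eq; apply: pureD.
have [x _|noG] := pickP (fun x : G => true).
  have [S maxS cardS] := facet_maximal_independent x facetE.
  have [T maxT cardT] := facet_maximal_independent x facetF.
  by apply/dim_eq; rewrite -cardS -cardT; apply: wcG.
(* Without vertices there is no nonempty face, so all facets are empty. *)
have empty K : facet Delta K -> K = set0.
  case/maxsetP=> KDelta _; apply/eqP/negPn/negP => K_neq0.
  have faceK : nonempty_face Delta K by rewrite /nonempty_face KDelta.
  by have := noG (Sub K faceK : G).
by rewrite (empty E) // (empty F).
Qed.

End Chains.

Theorem proposition2p1 (n : nat) (Delta : {set {set 'I_n}})
  (hDelta : simplicial_complex Delta) :
  class_G (noncomparability_graph Delta) /\
  (pure Delta <-> well_covered (noncomparability_graph Delta)).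
Proof.
split; [exact: class_G_noncomparability_graph|exact: pure_well_covered].
Qed.
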